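(* For an integer $T\ge 1$ let $$\mathcal F(T)=\{a/b:\ (a,b)\in\mathbb Z^2,\ 0\le a<b\le T,\ \gcd(a,b)=1\}$$ be the set of Farey fractions of order $T$, let $F(T)=\#\mathcal F(T)$, let $$G(T)=\sum_{\substack{\xi\in\mathcal F(T)\\ \xi\le 1/2}}\xi^2,$$ and let $$C(T)=\sum_{a/b\in\mathcal F(T)\cap[0,1/2]}\#\bigl(\mathcal F(T)\cap[1-a^2/b^2,\,1]\bigr),$$ where each $a/b$ is written in lowest terms. Let $M(t)=\sum_{1\le k\le t}\mu(k)$, where $\mu$ is the M\''obius function, and let $\delta(t)$ be any decreasing function such that $|M(t)|\le t\,\delta(t)$ holds for all $t\ge 1$. Then, as $T\to\infty$, $$C(T)=F(T)G(T)+O\bigl(T^{11/4+o(1)}+T^3\,\delta(T^{1/2})\log T\bigr),$$ where the implied constant is absolute.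
   Context: $\mu$ denotes the M\''obius function. The notation $A=O(B)$ means $|A|\le c|B|$ for an absolute constant $c>0$, and $o(1)$ denotes a quantity tending to $0$ as $T\to\infty$. *)

(* Defs.v *)
From HB Require Import structures.
From mathcomp Require Import all_boot all_order all_algebra.
From mathcomp Require Import all_classical all_reals all_analysis.
Set Implicit Arguments. Unset Strict Implicit. Unset Printing Implicit Defensive.
Import Order.TTheory GRing.Theory Num.Theory.
Local Open Scope ring_scope.

Definition mobius (n : nat) : int :=
  if (0 < n)%N && all (fun pe : nat * nat => pe.2 == 1%N) (prime_decomp n)
  then (-1) ^+ size (primes n) else 0.

Definition Mertens (R : realType) (t : R) : R :=
  \sum_(1 <= k < (Num.truncn t).+1) (mobius k)%:~R.

Definition farey (T a b : nat) : bool := [&& (a < b)%N, (b <= T)%N & coprime a b].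

Definition fr (R : realType) (a b : nat) : R := a%:R / b%:R.

Definition FareyF (R : realType) (T : nat) : R :=
  \sum_(b < T.+1) \sum_(a < T.+1 | farey T a b) 1.

Definition FareyG (R : realType) (T : nat) : R :=
  \sum_(b < T.+1) \sum_(a < T.+1 | farey T a b && (fr R a b <= 2^-1)) (fr R a b) ^+ 2.

Definition FareyC (R : realType) (T : nat) : R :=
  \sum_(b < T.+1) \sum_(a < T.+1 | farey T a b && (fr R a b <= 2^-1))
    (\sum_(d < T.+1) \sum_(c < T.+1 | [&& farey T c d,
          1 - (fr R a b) ^+ 2 <= fr R c d & fr R c d <= 1]) (1 : R)).

(* Main.v *)
(* The number of Farey fractions in [1 - x, 1] is [sum_m M(T/m) floor(m x)], while
   [F(T) = sum_m M(T/m) m], so with [psi] the centred fractional part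
     [C - F G = - sum_m M(T/m) S(m) - K/2],   [S(m) = sum_(a/b <= 1/2) psi(m a^2/b^2)],
   where [K] counts the Farey fractions up to [1/2] and [sum_m M(T/m) = 1] was used.
   For [m < sqrt T] bound [S(m)] trivially and [M(T/m)] by [(T/m) delta(sqrt T)].  For larger
   [m] bound [M(T/m)] trivially.  Moebius inversion again reduces [S(m)] to the sums of
   [psi(m a^2/b^2)] over all [a <= b/2].  The finite Fourier expansion of [psi] modulo [b^2],
   smoothed by averaging over short intervals, and Weyl differencing on blocks of length about
   [b^2/(h m)] for the frequency [h] bound these by [T^(3/4)] up to logarithms. *)
Require Import Defs.
From HB Require Import structures.
From mathcomp Require Import all_boot all_order all_algebra.
From mathcomp Require Import all_classical all_reals all_analysis.
From mathcomp Require Import ring lra zify.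
Import Order.TTheory GRing.Theory Num.Theory.
Import numFieldNormedType.Exports.
Local Open Scope classical_set_scope.
Local Open Scope ring_scope.

Set Implicit Arguments.
Unset Strict Implicit.
Unset Printing Implicit Defensive.

(** * The Moebius function *)

Lemma mobiusE n : mobius n =
  if (0 < n)%N && all (fun q => logn q n == 1%N) (primes n)
  then (-1) ^+ size (primes n) else 0.
Proof.
rewrite /mobius prime_decompE; congr (if _ && _ then _ else _).
by rewrite (all_map _ (fun pe : nat * nat => pe.2 == 1%N)).
Qed.

Lemma mobius_primeM_dvd p d : prime p -> (0 < d)%N -> (p %| d)%N -> mobius (p * d) = 0.
Proof.
move=> pr_p d_gt0 pd; rewrite mobiusE muln_gt0 prime_gt0 //= d_gt0 andTb.
case: ifP => // /allP /(_ p).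
rewrite mem_primes pr_p muln_gt0 prime_gt0 // d_gt0 dvdn_mulr // => /(_ isT) /eqP.
rewrite (lognM _ (prime_gt0 pr_p) d_gt0) (logn_prime _ pr_p) eqxx add1n => -[] /eqP.
by rewrite eqn0Ngt logn_gt0 mem_primes pr_p d_gt0 pd.
Qed.

Lemma mobius_primeM p d : prime p -> (0 < d)%N -> ~~ (p %| d)%N ->
  mobius (p * d) = - mobius d.
Proof.
move=> pr_p d_gt0 pd; rewrite !mobiusE muln_gt0 prime_gt0 // d_gt0 /=.
have pNd : p \notin primes d by rewrite mem_primes pr_p d_gt0.
have pe : perm_eq (primes (p * d)) (p :: primes d).
  apply: uniq_perm; rewrite ?primes_uniq //= ?pNd ?primes_uniq //.
  by move=> q; rewrite (primesM _ (prime_gt0 pr_p) d_gt0) (primes_prime pr_p) !inE.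
rewrite (perm_size pe) (perm_all _ pe) /= exprS mulN1r.
rewrite (lognM _ (prime_gt0 pr_p) d_gt0) (logn_prime _ pr_p) eqxx add1n eqSS.
have /eqP -> : logn p d == 0%N by rewrite eqn0Ngt logn_gt0.
rewrite eqxx /=.
have -> : all (fun q => logn q (p * d) == 1%N) (primes d) =
    all (fun q => logn q d == 1%N) (primes d).
  apply: eq_in_all => q qd.
  rewrite (lognM _ (prime_gt0 pr_p) d_gt0) (logn_prime _ pr_p).
  by case: (eqVneq q p) => [eqp|_]; [case/negP: pNd; rewrite -eqp | rewrite add0n].
by case: ifP => _; rewrite ?oppr0.
Qed.

Lemma mobius1 : mobius 1 = 1.
Proof. by rewrite /mobius. Qed.

Lemma big_dvd (V : nmodType) n e (f : nat -> V) : (0 < e)%N ->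
  \sum_(1 <= b < n.+1 | (e %| b)%N) f b = \sum_(1 <= m < (n %/ e).+1) f (m * e)%N.
Proof.
move=> e_gt0; elim: n => [|n IHn]; first by rewrite div0n !big_geq.
rewrite big_mkcond big_nat_recr //= -big_mkcond /= IHn divnS //.
case: ifP => dv; last by rewrite add0n addr0.
rewrite add1n [RHS]big_nat_recr //=; congr (_ + f _).
by have := divnK dv; rewrite divnS // dv add1n => ->.
Qed.

Lemma big_dvd0 (V : nmodType) n e (f : nat -> V) : (0 < e)%N ->
  \sum_(0 <= b < n * e | (e %| b)%N) f b = \sum_(0 <= m < n) f (m * e)%N.
Proof.
move=> e_gt0; case: n => [|n]; first by rewrite mul0n !big_geq.
rewrite big_ltn_cond ?muln_gt0 //= dvdn0 [RHS]big_ltn // mul0n; congr (_ + _).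
have -> : (n.+1 * e = (n * e + e.-1).+1)%N by rewrite -addnS prednK // mulSn addnC.
rewrite big_dvd // divnMDl // divn_small ?addn0 //.
by rewrite ltn_predL.
Qed.

(* Writing [n = p^k * r], the divisors of [n] prime to [p] cancel in pairs [d], [p * d]. *)
Lemma sum_mobius n : (0 < n)%N ->
  \sum_(1 <= d < n.+1 | (d %| n)%N) mobius d = (n == 1%N)%:R.
Proof.
case: n => // -[|n] _; first by rewrite big_mkcond big_nat1 mobius1.
set N := n.+2; set p := pdiv N.
have pr_p : prime p by apply: pdiv_prime.
have p_gt0 := prime_gt0 pr_p.
have pN : (p %| N)%N := pdiv_dvd N.
rewrite (bigID (fun d => p %| d)%N) /=.
under eq_bigl => d do rewrite andbC.
rewrite big_mkcondr /= big_dvd // -big_mkcond /=.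
have -> : \sum_(1 <= d < (N %/ p).+1 | (d * p %| N)%N) mobius (d * p)%N =
  \sum_(1 <= d < (N %/ p).+1 | (d * p %| N)%N && ~~ (p %| d)%N) - mobius d.
  rewrite [RHS]big_mkcondr /= big_nat_cond [RHS]big_nat_cond.
  apply: eq_bigr => d /andP[/andP[d1 _] _]; rewrite mulnC.
  by case: ifPn => pd; [rewrite mobius_primeM | rewrite mobius_primeM_dvd // -[(_ %| _)%N]negbK].
rewrite sumrN.
have eqc d : (d * p %| N)%N && ~~ (p %| d)%N = (d %| N)%N && ~~ (p %| d)%N.
  apply/andP/andP => -[dv npd]; split => //; first exact: dvdn_trans (dvdn_mulr p _) dv.
  by rewrite Gauss_dvd ?dv // coprime_sym prime_coprime.
rewrite (eq_bigl _ _ eqc).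
rewrite [X in _ + X](big_cat_nat (n := (N %/ p).+1)) //=; last first.
  by rewrite ltnS leq_div.
rewrite addrA addNr add0r big_nat_cond big1 // => d /andP[/andP[d1 _] dv].
suff : (d <= N %/ p)%N by rewrite leqNgt d1.
rewrite -eqc in dv; case/andP: dv => dv _.
by rewrite leq_divRL //; apply: dvdn_leq.
Qed.

Section RealSums.
Variable R : realType.
Implicit Types (x theta phi : R).

(** * Sums over Farey fractions *)

Lemma Mertens_div T m : (0 < m)%N ->
  Mertens (T%:R / m%:R : R) = \sum_(1 <= e < (T %/ m).+1) (mobius e)%:~R.
Proof.
move=> m_gt0; rewrite /Mertens; congr (\sum_(1 <= e < _.+1) _).
have m0 : 0 < m%:R :> R by rewrite ltr0n.
apply/eqP; rewrite -[_ == _]/(_ == _ :> nat) truncn_eq ?divr_ge0 ?ler0n //.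
rewrite ler_pdivlMr // ltr_pdivrMr // -!natrM ler_nat ltr_nat.
by rewrite leq_trunc_div mulSn addnC {1}(divn_eq T m) ltn_add2l ltn_mod m_gt0.
Qed.

Lemma sum_mobius_dvd n m : (0 < n)%N -> (n <= m)%N ->
  \sum_(1 <= e < m.+1 | (e %| n)%N) (mobius e)%:~R = (n == 1%N)%:R :> R.
Proof.
move=> n_gt0 le_nm; rewrite -[RHS](rmorph_nat (intmul (1 : R))) -sum_mobius //.
rewrite rmorph_sum /= (big_cat_nat (n := n.+1)) //= [X in _ + X]big_nat_cond.
rewrite [X in _ + X]big1 ?addr0 // => e /andP[/andP[lt_ne _] /dvdn_leq].
by move=> /(_ n_gt0); rewrite leqNgt lt_ne.
Qed.

Lemma farey_sum_nat (V : nmodType) (h : nat -> nat -> V) T :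
  \sum_(b < T.+1) \sum_(a < T.+1 | farey T a b) h a b =
  \sum_(1 <= b < T.+1) \sum_(0 <= a < b | coprime a b) h a b.
Proof.
rewrite -(big_mkord predT (fun b => \sum_(a < T.+1 | farey T a b) h a b)).
rewrite big_ltn // big1 ?add0r; last by move=> a; rewrite /farey ltn0.
rewrite big_nat_cond [RHS]big_nat_cond; apply: eq_bigr => b /andP[/andP[b1 bT] _].
rewrite -(big_mkord (fun a => farey T a b) (fun a => h a b)).
rewrite [RHS](big_nat_widen _ _ T.+1) ?(ltnW bT) //; apply: eq_bigl => a.
by rewrite /farey -(ltnS b) bT andbC.
Qed.

Lemma farey_sum (h : nat -> nat -> R) T :
  (forall e a b, (0 < e)%N -> h (a * e)%N (b * e)%N = h a b) ->
  \sum_(b < T.+1) \sum_(a < T.+1 | farey T a b) h a b =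
  \sum_(1 <= m < T.+1) Mertens (T%:R / m%:R) * \sum_(0 <= a < m) h a m.
Proof.
move=> hs; rewrite farey_sum_nat.
pose c (e : nat) : R := (mobius e)%:~R.
transitivity (\sum_(1 <= b < T.+1) \sum_(1 <= e < T.+1 | (e %| b)%N)
    \sum_(0 <= a < b | (e %| a)%N) c e * h a b).
  apply: eq_big_nat => b /andP[b1 bT].
  transitivity (\sum_(0 <= a < b) \sum_(1 <= e < T.+1 | (e %| b)%N && (e %| a)%N)
      c e * h a b).
    rewrite big_mkcond /=; apply: eq_big_nat => a /andP[_ ab].
    rewrite -big_distrl /=.
    have g_gt0 : (0 < gcdn a b)%N by rewrite gcdn_gt0 b1 orbT.
    have gT : (gcdn a b <= T)%N by rewrite (leq_trans (dvdn_leq b1 (dvdn_gcdr a b))).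
    rewrite (eq_bigl (fun e => e %| gcdn a b)%N); last first.
      by move=> e; rewrite dvdn_gcd andbC.
    rewrite sum_mobius_dvd // /coprime.
    by case: eqP => _; rewrite ?mul1r ?mul0r.
  under eq_bigr => a _ do rewrite big_mkcondr /=.
  rewrite exchange_big /=; apply: eq_bigr => e _.
  by rewrite -big_mkcond.
transitivity (\sum_(1 <= e < T.+1) \sum_(1 <= m < T.+1)
    if (m * e <= T)%N then c e * \sum_(0 <= a < m) h a m else 0).
  under eq_bigr => b _ do rewrite big_mkcond /=.
  rewrite exchange_big_nat /=; apply: eq_big_nat => e /andP[e1 eT].
  rewrite -big_mkcond big_dvd // -big_mkcond /=.
  rewrite [RHS](eq_bigl (fun m => predT m && (m < (T %/ e).+1)%N)); last first.
    by move=> m; rewrite /= ltnS leq_divRL.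
  rewrite -big_nat_widen ?ltnS ?leq_div //; apply: eq_big_nat => m /andP[m1 _].
  rewrite big_dvd0 // big_distrr /=; apply: eq_bigr => a _.
  by rewrite hs.
rewrite exchange_big_nat /=; apply: eq_big_nat => m /andP[m1 mT].
rewrite Mertens_div // -big_mkcond /= big_distrl /=.
rewrite (eq_bigl (fun e => predT e && (e < (T %/ m).+1)%N)); last first.
  by move=> e; rewrite /= ltnS leq_divRL // mulnC.
by rewrite -big_nat_widen ?ltnS ?leq_div.
Qed.

(** * Quadratic exponential sums *)

Lemma sum_cos_telescope x phi A n :
  (\sum_(A <= i < A + n) cos (x * i%:R *+ 2 + phi)) * sin x *+ 2 =
  sin (x * (A + n)%:R *+ 2 + phi - x) - sin (x * A%:R *+ 2 + phi - x).
Proof.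
elim: n => [|n IHn]; first by rewrite addn0 big_geq // mul0r mul0rn subrr.
rewrite addnS big_nat_recr ?leq_addr //= mulrDl mulrnDl IHn.
set y := x * (A + n)%:R *+ 2 + phi.
have -> : x * (A + n).+1%:R *+ 2 + phi - x = y + x by rewrite /y -natr1; ring.
rewrite (sinD y x) (sinB y x); ring.
Qed.

Lemma sum_sin_telescope x phi A n :
  (\sum_(A <= i < A + n) sin (x * i%:R *+ 2 + phi)) * sin x *+ 2 =
  cos (x * A%:R *+ 2 + phi - x) - cos (x * (A + n)%:R *+ 2 + phi - x).
Proof.
elim: n => [|n IHn]; first by rewrite addn0 big_geq // mul0r mul0rn subrr.
rewrite addnS big_nat_recr ?leq_addr //= mulrDl mulrnDl IHn.
set y := x * (A + n)%:R *+ 2 + phi.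
have -> : x * (A + n).+1%:R *+ 2 + phi - x = y + x by rewrite /y -natr1; ring.
rewrite (cosD y x) (cosB y x); ring.
Qed.

Lemma sum_cos_linear_le x phi A n : 0 < sin x ->
  `|\sum_(A <= i < A + n) cos (x * i%:R *+ 2 + phi)| <= (sin x)^-1.
Proof.
move=> sx; rewrite -[leRHS]mul1r ler_pdivlMr //.
rewrite -[in leLHS](gtr0_norm sx) -normrM -(ler_pMn2r (ltn0Sn 1)) -normrMn.
rewrite sum_cos_telescope (le_trans (ler_normB _ _)) //.
by rewrite mulr2n lerD // sin_max.
Qed.

Lemma sin_ge_quarter x : 0 <= x -> x <= pi / 2 -> x / 4 <= sin x.
Proof.
move=> x0 xpi.
have pi2 := @pihalf_lt2 R; have pi1 := @pihalf_ge1 R.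
have p4 : 0 < pi / 4 :> R by lra.
have c4 : 2^-1 <= cos (pi / 4) :> R.
  have c0 : 0 < cos (pi / 4) :> R by apply: cos_gt0_pihalf; lra.
  have := cos_mulr2n (pi / 4 : R).
  have -> : (pi / 4) *+ 2 = pi / 2 :> R by lra.
  rewrite cos_pihalf => e; rewrite leNgt; apply/negP => lt.
  have : cos (pi / 4) ^+ 2 <= 2^-1 ^+ 2 :> R by rewrite ler_pXn2r // ?nnegrE; lra.
  lra.
have [xs|xl] := leP x (pi / 4).
  have [->|xn0] := eqVneq x 0; first by rewrite sin0 mul0r.
  have xgt0 : 0 < x by rewrite lt_neqAle eq_sym xn0.
  have ds y : y \in `]0, x[ -> is_derive y 1 (@sin R) (cos y).
    by move=> _; exact: is_derive_sin.
  have cs : {within `[0, x], continuous (@sin R)}.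
    by apply: continuous_subspaceT => y; apply: continuous_sin.
  have [c] := MVT_segment x0 ds cs.
  rewrite in_itv /= => /andP[c0 cx]; rewrite sin0 !subr0 => ->.
  have : cos (pi / 4) <= cos c.
    rewrite leNgt ltr_cos ?in_itv /=; [lra|lra|lra].
  nra.
have : sin (pi / 4) <= sin x.
  rewrite leNgt ltr_sin ?in_itv /=; lra.
have -> : sin (pi / 4) = cos (pi / 4) :> R.
  rewrite -cosBpihalf -cosN; congr cos; lra.
lra.
Qed.

Lemma sum_pairs_diff (f : nat -> nat -> R) A L :
  (forall a b, f a b = f b a) ->
  \sum_(A <= a < A + L) \sum_(A <= b < A + L) f a b =
  \sum_(A <= a < A + L) f a a +
  (\sum_(1 <= k < L) \sum_(A <= a < A + (L - k)) f (a + k)%N a) *+ 2.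
Proof.
move=> fC; elim: L => [|L IHL]; first by rewrite !(big_geq (m := A)) ?addn0 // big_geq // mulr2n !addr0.
rewrite addnS !(big_nat_recr _ _ _ (leq_addr L A)) /=.
under eq_bigr => a _ do rewrite (big_nat_recr _ _ _ (leq_addr L A)) /=.
rewrite big_split /= IHL.
have -> : \sum_(1 <= k < L.+1) \sum_(A <= a < A + (L.+1 - k)) f (a + k)%N a =
    \sum_(1 <= k < L) \sum_(A <= a < A + (L - k)) f (a + k)%N a +
    \sum_(A <= a < A + L) f (A + L)%N a.
  transitivity (\sum_(1 <= k < L.+1) (\sum_(A <= a < A + (L - k)) f (a + k)%N a +
      f (A + L)%N (A + (L - k))%N)).
    apply: eq_big_nat => k /andP[k1 kL]; rewrite subSn // addnS.
    rewrite big_nat_recr ?leq_addr //=; congr (_ + f _ _).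
    by rewrite -addnA subnK.
  rewrite big_split /=; congr (_ + _).
    case: L {IHL} => [|L]; first by rewrite !big_geq.
    by rewrite big_nat_recr //= subnn addn0 (big_geq (leqnn A)) addr0.
  have -> : \sum_(A <= a < A + L) f (A + L)%N a = \sum_(0 <= i < L) f (A + L)%N (i + A)%N.
    by rewrite -{1}[A]add0n big_addn addKn.
  rewrite big_add1 /=.
  rewrite [RHS]big_nat_rev /=; apply: eq_big_nat => k /andP[_ kL].
  by congr (f _ _); rewrite add0n addnC.
rewrite (eq_bigr (fun a => f (A + L)%N a)); last by move=> a _; rewrite fC.
ring.
Qed.

Lemma sqr_sum_cos_le (y : nat -> R) phi A L :
  (\sum_(A <= a < A + L) cos (y a + phi)) ^+ 2 <=
  \sum_(A <= a < A + L) \sum_(A <= b < A + L) cos (y a - y b).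
Proof.
have -> : \sum_(A <= a < A + L) \sum_(A <= b < A + L) cos (y a - y b) =
    (\sum_(A <= a < A + L) cos (y a + phi)) ^+ 2 +
    (\sum_(A <= a < A + L) sin (y a + phi)) ^+ 2.
  rewrite !expr2 !big_distrl -big_split /=; apply: eq_bigr => a _.
  rewrite !big_distrr -big_split /=; apply: eq_bigr => b _.
  by rewrite -cosB; congr cos; ring.
by rewrite lerDl sqr_ge0.
Qed.

Definition harmsum n : R := \sum_(1 <= k < n.+1) k%:R^-1.

Lemma harmsum_le : {homo harmsum : m n / (m <= n)%N >-> m <= n}.
Proof.
move=> m n le_mn; rewrite /harmsum [leRHS](big_cat_nat (n := m.+1)) //= lerDl.
by apply: sumr_ge0 => k _; rewrite invr_ge0 ler0n.
Qed.

Lemma harmsum_ge1 n : (0 < n)%N -> 1 <= harmsum n.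
Proof.
move=> n_gt0; apply: le_trans (harmsum_le n_gt0).
by rewrite /harmsum big_nat1 invr1.
Qed.

Lemma sum_cos_sqr_block_le theta phi A L :
  0 < theta -> theta * L%:R <= 1 ->
  (\sum_(A <= a < A + L) cos (theta * a%:R ^+ 2 + phi)) ^+ 2 <=
  9 * harmsum L / theta.
Proof.
move=> th0 thL.
case: L thL => [|L] thL.
  rewrite addn0 big_geq // expr0n /= /harmsum big_geq // mulr0 mul0r //.
apply: le_trans (sqr_sum_cos_le _ phi A L.+1) _.
rewrite sum_pairs_diff; last by move=> a b; rewrite -cosN opprB.
under eq_bigr => a _ do rewrite subrr cos0.
rewrite big_const_nat addKn iter_addr_0.
have HL : 1 <= harmsum L.+1 by apply: harmsum_ge1.
have -> : 9 * harmsum L.+1 / theta = harmsum L.+1 / theta + harmsum L.+1 * (4 / theta) *+ 2.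
  by field; rewrite gt_eqF.
apply: lerD.
  rewrite ler_pdivlMr // (le_trans _ HL) // mulrC //.
rewrite ler_pMn2r //.
apply: le_trans (_ : harmsum L * (4 / theta) <= _); last first.
  by rewrite ler_pM2r ?divr_gt0 // harmsum_le.
rewrite /harmsum big_distrl /=; apply: ler_sum_nat => k /andP[k1 kL].
have k0 : 0 < k%:R :> R by rewrite ltr0n.
have kL' : k%:R <= L.+1%:R :> R by rewrite ler_nat ltnW.
have s4 : theta * k%:R / 4 <= sin (theta * k%:R).
  apply: sin_ge_quarter; first by rewrite mulr_ge0 ?ltW.
  have := @pihalf_ge1 R; nra.
have s0 : 0 < theta * k%:R / 4 by rewrite divr_gt0 ?mulr_gt0.
have -> : k%:R^-1 * (4 / theta) = (theta * k%:R / 4)^-1.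
  by field; rewrite !gt_eqF.
apply: le_trans (_ : (sin (theta * k%:R))^-1 <= _); last first.
  by rewrite lef_pV2 // posrE (lt_le_trans s0).
rewrite (eq_bigr (fun a => cos (theta * k%:R * a%:R *+ 2 + theta * k%:R ^+ 2))); last first.
  by move=> a _; rewrite natrD; congr cos; ring.
apply: le_trans (ler_norm _) _.
by apply: sum_cos_linear_le; apply: lt_le_trans s4.
Qed.

Lemma sum_blocks_le (g : nat -> R) L B q A n :
  (forall A n, (n <= L)%N -> `|\sum_(A <= a < A + n) g a| <= B) ->
  (n <= q * L)%N -> `|\sum_(A <= a < A + n) g a| <= B *+ q.
Proof.
move=> gB; elim: q A n => [|q IHq] A n.
  by rewrite leqn0 => /eqP ->; rewrite addn0 big_geq // normr0 mulr0n.
have [nL _|Ln nqL] := leqP n L.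
  apply: le_trans (gB A n nL) _; rewrite mulrS lerDl mulrn_wge0 //.
  exact: le_trans (normr_ge0 _) (gB A n nL).
rewrite (big_cat_nat (n := A + L)) ?leq_addr ?leq_add2l ?(ltnW Ln) //=.
rewrite (le_trans (ler_normD _ _)) // mulrS lerD ?gB //.
rewrite -{1}(subnKC (ltnW Ln)) addnA IHq //.
by rewrite leq_subLR -mulSn.
Qed.

Lemma sum_cos_sqr_le theta phi N H :
  0 < theta -> 1 <= H -> harmsum (Num.truncn theta^-1) <= H ->
  `|\sum_(0 <= a < N) cos (theta * a%:R ^+ 2 + phi)| <=
  H * (6 * N%:R * Num.sqrt theta + 3 / Num.sqrt theta).
Proof.
move=> th0 H1 hH; set s := Num.sqrt theta.
have s0 : 0 < s by rewrite sqrtr_gt0.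
have ss : s ^+ 2 = theta by rewrite sqr_sqrtr // ltW.
have N0 : 0 <= N%:R :> R by [].
have s30 : 0 < 3 / s by rewrite divr_gt0.
have [th1|th1] := leP theta 1; last first.
  apply: (@le_trans _ _ N%:R).
    apply: le_trans (ler_norm_sum _ _ _) _.
    rewrite -[N in N%:R](subn0 N) -sumr_const_nat.
    by apply: ler_sum => a _; apply: cos_max.
  have s1 : 1 <= s by rewrite leNgt; apply/negP => sl; nra.
  have : N%:R <= N%:R * s by rewrite ler_peMr.
  nra.
set L := Num.truncn theta^-1 in hH *.
have thV : 1 <= theta^-1 by rewrite invf_ge1.
have L1 : (1 <= L)%N by rewrite truncn_gt0.
have /andP[Lle Llt] : L%:R <= theta^-1 < L.+1%:R by apply: truncn_itv; rewrite invr_ge0 ltW.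
have thL : theta * L%:R <= 1 by rewrite mulrC -ler_pdivlMr // div1r.
have th2L : 1 <= theta * L%:R * 2.
  have : 1 < theta * L.+1%:R by rewrite mulrC -ltr_pdivrMr // div1r.
  have : 1 <= L%:R :> R by rewrite ler1n.
  rewrite -natr1; nra.
have L0 : 0 < L%:R :> R by rewrite ltr0n.
have blk A n : (n <= L)%N ->
    `|\sum_(A <= a < A + n) cos (theta * a%:R ^+ 2 + phi)| <= 3 * H / s.
  move=> nL; rewrite -(ler_pXn2r (ltn0Sn 1)) ?nnegrE ?divr_ge0 ?mulr_ge0 //; first last.
  - exact: ltW.
  - lra.
  rewrite real_normK ?num_real //.
  apply: le_trans (@sum_cos_sqr_block_le theta phi A n th0 _) _.
    by apply: le_trans thL; rewrite ler_pM2l // ler_nat.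
  rewrite expr_div_n ss ler_pM2r ?invr_gt0 //.
  have : harmsum n <= H by apply: le_trans hH; apply: harmsum_le.
  nra.
have := @sum_blocks_le _ L _ (N %/ L).+1 0 N blk; rewrite add0n => /(_ _) h.
apply: le_trans (h _) _; first by rewrite ltnW // ltn_ceil.
have -> : 3 * H / s *+ (N %/ L).+1 = 3 * H / s * ((N %/ L)%:R + 1).
  by rewrite natr1 mulr_natr.
have NL : (N %/ L)%:R <= 2 * N%:R * theta.
  have : (N %/ L)%:R * L%:R <= N%:R :> R by rewrite -natrM ler_nat leq_trunc_div.
  have := ler0n R (N %/ L); nra.
have -> : H * (6 * N%:R * s + 3 / s) = 3 * H / s * (2 * N%:R * theta + 1).
  by rewrite -ss; field; rewrite gt_eqF.
rewrite ler_pM2l ?lerD2r // divr_gt0 // mulr_gt0 //; lra.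
Qed.

Lemma sin_frac_gt0 D h : (1 <= h < D)%N -> 0 < sin (pi * h%:R / D%:R) :> R.
Proof.
move=> /andP[h1 hD]; have p0 := @pi_gt0 R.
have D0 : 0 < D%:R :> R by rewrite ltr0n (leq_ltn_trans _ hD).
apply: sin_gt0_pi; rewrite divr_gt0 ?mulr_gt0 // ?ltr0n //= ltr_pdivrMr //.
by rewrite ltr_pM2l // ltr_nat.
Qed.

(** * The sawtooth function *)

Definition psi D j : R := (j %% D)%:R / D%:R - 2^-1.

Lemma cos_natpi2 phi n : cos (phi + pi * n%:R * 2) = cos phi.
Proof.
have -> : pi * n%:R * 2 = pi *+ 2 *+ n :> R by ring.
by rewrite (periodicn (@cosD2pi R)).
Qed.

Lemma sum_cos_char D n : (0 < D)%N ->
  \sum_(1 <= h < D) cos (pi * h%:R / D%:R * n%:R *+ 2) = (D %| n)%:R * D%:R - 1 :> R.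
Proof.
move=> D_gt0; have D0 : D%:R != 0 :> R by rewrite pnatr_eq0 -lt0n.
suff : \sum_(0 <= h < D) cos (pi * n%:R / D%:R * h%:R *+ 2 + 0) = (D %| n)%:R * D%:R :> R.
  rewrite big_ltn // mulr0 mul0rn addr0 cos0 => <-; rewrite addrC addKr.
  by apply: eq_bigr => h _; rewrite addr0; congr (cos (_ *+ 2)); ring.
have [/dvdnP[q ->]|ndv] := boolP (D %| n)%N.
  rewrite (eq_bigr (fun=> 1)); first by rewrite sumr_const_nat subn0 mul1r.
  move=> h _; rewrite -[RHS]cos0 -[RHS](cos_natpi2 _ (q * h)) !natrM; congr cos.
  by field.
have sx : sin (pi * n%:R / D%:R) != 0 :> R.
  have -> : pi * n%:R / D%:R = pi * (n %% D)%:R / D%:R + pi *+ (n %/ D) :> R.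
    by rewrite {1}(divn_eq n D) natrD natrM; field.
  rewrite (alternatingn (@sinDpi R)) mulf_neq0 ?signr_eq0 // gt_eqF //.
  have D0' : 0 < D%:R :> R by rewrite ltr0n.
  have r0 : 0 < (n %% D)%:R :> R by rewrite ltr0n lt0n.
  have rD : (n %% D)%:R < D%:R :> R by rewrite ltr_nat ltn_mod.
  have p0 := @pi_gt0 R.
  apply: sin_gt0_pi; rewrite divr_gt0 ?mulr_gt0 //= ltr_pdivrMr //.
  by rewrite ltr_pM2l.
have := sum_cos_telescope (pi * n%:R / D%:R) 0 0 D.
rewrite add0n mul0r => e; apply/eqP; move: e.
rewrite mulr0 mul0rn !addr0 sub0r.
have -> : pi * n%:R / D%:R * D%:R *+ 2 - pi * n%:R / D%:R =
    - (pi * n%:R / D%:R) + pi *+ 2 *+ n :> R by field.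
rewrite (periodicn (@sinD2pi R)) subrr => /eqP.
by rewrite mulrn_eq0 mulf_eq0 (negbTE sx) orbF.
Qed.

(* Both sides grow by [1/D] at each step, except for a drop by [1] when [D] divides [j.+1]. *)
Lemma psi_fourier D j : (0 < D)%N ->
  psi D j = - (2 * D%:R)^-1 * (1 + \sum_(1 <= h < D)
    sin (pi * h%:R / D%:R * (2 * j%:R + 1)) / sin (pi * h%:R / D%:R)).
Proof.
move=> D_gt0; have D0 : 0 < D%:R :> R by rewrite ltr0n.
have sx := @sin_frac_gt0 D.
elim: j => [|j IHj].
  rewrite (eq_big_nat _ _ (F2 := fun=> 1)); last first.
    by move=> h hD; rewrite mulr0 add0r mulr1 divff // gt_eqF // sx.
  rewrite sumr_const_nat natrB // /psi mod0n mul0r; field; exact: lt0r_neq0.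
have -> : psi D j.+1 = psi D j + D%:R^-1 - (D %| j.+1)%:R.
  rewrite /psi modnS; case: ifP => [dv|_] /=; last by rewrite -natr1; field; exact: lt0r_neq0.
  have -> : (j %% D)%:R = D%:R - 1 :> R.
    have rD : (j %% D).+1 = D.
      apply/eqP; rewrite eqn_leq ltn_mod D_gt0 dvdn_leq //.
      by move: dv; rewrite {1}(divn_eq j D) -addnS dvdn_addr ?dvdn_mull.
    by rewrite -[in RHS]rD -natr1 addrK.
  by field; exact: lt0r_neq0.
rewrite IHj.
have -> : \sum_(1 <= h < D) sin (pi * h%:R / D%:R * (2 * j.+1%:R + 1)) / sin (pi * h%:R / D%:R)
  = \sum_(1 <= h < D) sin (pi * h%:R / D%:R * (2 * j%:R + 1)) / sin (pi * h%:R / D%:R)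
  + 2 * \sum_(1 <= h < D) cos (pi * h%:R / D%:R * j.+1%:R *+ 2) :> R.
  rewrite big_distrr -big_split /=; apply: eq_big_nat => h /sx; set x := _ / _ => s0.
  have -> : x * (2 * j.+1%:R + 1) = x * j.+1%:R *+ 2 + x by ring.
  have -> : x * (2 * j%:R + 1) = x * j.+1%:R *+ 2 - x by rewrite -natr1; ring.
  rewrite sinD sinB; field; exact: lt0r_neq0.
rewrite sum_cos_char //; field; exact: lt0r_neq0.
Qed.

Lemma psiD_le D j t : (0 < D)%N -> psi D (j + t) <= psi D j + t%:R / D%:R.
Proof.
move=> D_gt0; rewrite /psi addrAC lerD2r -mulrDl -natrD.
by rewrite ler_pM2r ?invr_gt0 ?ltr0n // ler_nat -modnDml leq_mod.
Qed.

Lemma psiDM D j k : psi D (j + k * D) = psi D j.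
Proof. by rewrite /psi addnC modnMDl. Qed.

Lemma sum_psi_box_le D I N (j : nat -> nat) (B : nat -> R) s : (0 < D)%N -> (0 < I)%N ->
  (forall h phi, (1 <= h < D)%N ->
    `|\sum_(0 <= a < N) cos (pi * h%:R / D%:R * (j a)%:R *+ 2 + phi)| <= B h) ->
  `|\sum_(0 <= a < N) \sum_(0 <= i < I) psi D (j a + s + i)| <=
  I%:R * ((2 * D%:R)^-1 * (N%:R + \sum_(1 <= h < D) B h *
    Num.min 1 (I%:R * sin (pi * h%:R / D%:R))^-1 / sin (pi * h%:R / D%:R))).
Proof.
move=> D_gt0 I_gt0 hB.
have D0 : 0 < D%:R :> R by rewrite ltr0n.
have I0 : 0 < I%:R :> R by rewrite ltr0n.
pose x h : R := pi * h%:R / D%:R.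
pose W h := \sum_(0 <= a < N) \sum_(0 <= i < I) sin (x h * (2 * (j a + s + i)%:R + 1)).
have -> : \sum_(0 <= a < N) \sum_(0 <= i < I) psi D (j a + s + i) =
    - (2 * D%:R)^-1 * (N%:R * I%:R + \sum_(1 <= h < D) W h / sin (x h)).
  under eq_bigr => a _ do under eq_bigr => i _ do rewrite psi_fourier //.
  under eq_bigr => a _ do rewrite -big_distrr /=.
  rewrite -big_distrr /=; congr (_ * _).
  under eq_bigr => a _ do rewrite big_split /= sumr_const_nat subn0 exchange_big /=.
  rewrite big_split /= sumr_const_nat subn0 -mulrnA; congr (_ + _).
    by rewrite mulnC natrM.
  rewrite exchange_big /=; apply: eq_bigr => h _.
  rewrite /W big_distrl; apply: eq_bigr => a _.
  by rewrite big_distrl.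
have c0 : 0 < (2 * D%:R)^-1 :> R by rewrite invr_gt0 mulr_gt0.
rewrite normrM normrN (gtr0_norm c0) [leRHS]mulrCA (ler_pM2l c0).
apply: le_trans (ler_normD _ _) _; rewrite mulrDr; apply: lerD.
  by rewrite ger0_norm ?mulr_ge0 // mulrC.
apply: le_trans (ler_norm_sum _ _ _) _; rewrite big_distrr /=.
apply: ler_sum_nat => h hD; have sx := sin_frac_gt0 hD.
rewrite -/(x h) in sx *.
rewrite normrM (gtr0_norm (x := (sin (x h))^-1)) ?invr_gt0 // !mulrA.
rewrite ler_pM2r ?invr_gt0 //.
have W1 : `|W h| <= I%:R * B h.
  rewrite /W exchange_big /=.
  apply: le_trans (ler_norm_sum _ _ _) _.
  have -> : I%:R * B h = \sum_(0 <= i < I) B h by rewrite sumr_const_nat subn0 mulr_natl.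
  apply: ler_sum => i _.
  rewrite (eq_bigr (fun a => cos (pi * h%:R / D%:R * (j a)%:R *+ 2 +
    (x h * (2 * (s + i)%:R + 1) - pi / 2)))); first exact: hB.
  move=> a _; rewrite addrA -/(x h) -(cosBpihalf (x h * _)) -addnA natrD; congr cos; ring.
have W2 : `|W h| <= B h / sin (x h).
  rewrite ler_pdivlMr // -(ler_pMn2r (ltn0Sn 1)).
  rewrite -{1}(gtr0_norm sx) -normrM -normrMn /W big_distrl -sumrMnl /=.
  pose c t a := cos (pi * h%:R / D%:R * (j a)%:R *+ 2 + x h * t *+ 2).
  rewrite (eq_bigr (fun a => c s%:R a - c (s + I)%:R a)); last first.
    move=> a _.
    transitivity ((\sum_(0 <= i < 0 + I) sin (x h * i%:R *+ 2 + x h * (2 * (j a + s)%:R + 1)))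
        * sin (x h) *+ 2).
      congr (_ * _ *+ 2); rewrite add0n; apply: eq_bigr => i _; congr sin.
      by rewrite (natrD _ (j a + s)); ring.
    rewrite sum_sin_telescope add0n mulr0 mul0rn add0r /c -/(x h).
    by congr (cos _ - cos _); rewrite !natrD; ring.
  rewrite sumrB (le_trans (ler_normB _ _)) // mulr2n lerD //; exact: hB.
rewrite -mulrA.
have B0 : 0 <= B h.
  by move: (le_trans (normr_ge0 _) W1); rewrite pmulr_rge0.
rewrite [Num.min _ _]/Order.min; case: ifP => _; first by rewrite mulr1.
apply: le_trans W2 _; rewrite le_eqVlt; apply/orP; left; apply/eqP.
by field; rewrite !gt_eqF.
Qed.

(* [psi] never drops faster than it can grow, so it lies between its averages over the
   [I] points following, respectively preceding, the argument, up to [I / D]. *)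
Lemma sum_psi_le D I N (j : nat -> nat) (B : nat -> R) : (0 < D)%N -> (0 < I)%N ->
  (forall h phi, (1 <= h < D)%N ->
    `|\sum_(0 <= a < N) cos (pi * h%:R / D%:R * (j a)%:R *+ 2 + phi)| <= B h) ->
  `|\sum_(0 <= a < N) psi D (j a)| <= N%:R * I%:R / D%:R +
  (2 * D%:R)^-1 * (N%:R + \sum_(1 <= h < D) B h *
    Num.min 1 (I%:R * sin (pi * h%:R / D%:R))^-1 / sin (pi * h%:R / D%:R)).
Proof.
move=> D_gt0 I_gt0 hB.
have box s := sum_psi_box_le s D_gt0 I_gt0 hB.
move: box; set E := (2 * D%:R)^-1 * _ => box.
have D0 : 0 < D%:R :> R by rewrite ltr0n.
have I0 : 0 < I%:R :> R by rewrite ltr0n.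
have cst n (c : R) : n%:R * c = \sum_(0 <= i < n) c.
  by rewrite sumr_const_nat subn0 mulr_natl.
pose s := (I * D - I + 1)%N.
have ID : (I <= I * D)%N by rewrite leq_pmulr.
rewrite -(ler_pM2l I0) -[X in X * `|_|](gtr0_norm I0) -normrM.
have -> : I%:R * (N%:R * I%:R / D%:R + E) = N%:R * (I%:R * (I%:R / D%:R)) + I%:R * E by ring.
rewrite ler_norml; apply/andP; split.
  have := box 0%N; rewrite ler_norml => /andP[+ _]; rewrite lerNl => lo.
  rewrite lerNl; apply: le_trans (lerD (lexx _) lo).
  rewrite lerNl opprB lerBlDr addrC.
  rewrite (cst N) big_distrr -big_split /=.
  apply: ler_sum => a _.
  rewrite (cst I (I%:R / D%:R)) (cst I (psi _ _)) -big_split /=.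
  apply: ler_sum_nat => i /andP[_ iI]; rewrite addn0.
  apply: le_trans (psiD_le _ _ D_gt0) _; rewrite [leRHS]addrC lerD2l.
  by rewrite ler_pM2r ?invr_gt0 // ler_nat ltnW.
have := box s; rewrite ler_norml => /andP[_ hi].
apply: le_trans (lerD (lexx _) hi).
rewrite (cst N) big_distrr -big_split /=.
apply: ler_sum => a _.
rewrite (cst I (I%:R / D%:R)) (cst I (psi _ _)) -big_split /=.
apply: ler_sum_nat => i /andP[_ iI]; rewrite -[in leLHS](psiDM D _ I).
have -> : (j a + I * D = j a + s + i + (I - i.+1))%N by rewrite /s; lia.
apply: le_trans (psiD_le _ _ D_gt0) _; rewrite [leRHS]addrC lerD2l.
by rewrite ler_pM2r ?invr_gt0 // ler_nat leq_subr.
Qed.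

Lemma sin_frac_sym D h : (0 < h < D)%N ->
  sin (pi * (D - h)%:R / D%:R) = sin (pi * h%:R / D%:R) :> R.
Proof.
move=> /andP[h0 hD]; have D0 : D%:R != 0 :> R by rewrite pnatr_eq0 -lt0n (leq_ltn_trans _ hD).
have -> : pi * (D - h)%:R / D%:R = - (pi * h%:R / D%:R) + pi :> R.
  by rewrite natrB ?(ltnW hD) //; field.
by rewrite sinDpi sinN opprK.
Qed.

Lemma cos_frac_sym D h n phi : (0 < h < D)%N ->
  cos (pi * (D - h)%:R / D%:R * n%:R *+ 2 + phi) =
  cos (pi * h%:R / D%:R * n%:R *+ 2 - phi) :> R.
Proof.
move=> /andP[h0 hD]; have D0 : D%:R != 0 :> R by rewrite pnatr_eq0 -lt0n (leq_ltn_trans _ hD).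
rewrite -[RHS]cosN -[RHS](cos_natpi2 _ n); congr cos.
by rewrite natrB ?(ltnW hD) //; field.
Qed.

Lemma sin_frac_ge D u : (0 < u)%N -> (2 * u <= D)%N ->
  u%:R / (2 * D%:R) <= sin (pi * u%:R / D%:R) :> R.
Proof.
move=> u0 uD; have D0 : 0 < D%:R :> R by rewrite ltr0n; lia.
have p0 := @pi_gt0 R; have p2 := @pi_ge2 R.
have uD' : 2 * u%:R <= D%:R :> R by rewrite -natrM ler_nat.
have u0' : 0 < u%:R :> R by rewrite ltr0n.
apply: le_trans (_ : pi * u%:R / D%:R / 4 <= _).
  have -> : u%:R / (2 * D%:R) = 2 * u%:R / D%:R / 4 :> R by field; exact: lt0r_neq0.
  by rewrite ler_pM2r // ler_pM2r ?invr_gt0 // ler_pM2r.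
apply: sin_ge_quarter; first by rewrite divr_ge0 ?mulr_ge0 // ltW.
rewrite ler_pdivrMr //; nra.
Qed.

Lemma min1_le_sqrt (z : R) : 0 <= z -> Num.min 1 z <= Num.sqrt z.
Proof.
move=> z0; have s0 := sqrtr_ge0 z; have ss := sqr_sqrtr z0.
rewrite /Order.min; case: ltP => h; last by nra.
by rewrite leNgt; apply/negP => s1; nra.
Qed.

Lemma sum_psi_quadratic_le m b I N H : (0 < m)%N -> (0 < b)%N -> (0 < I)%N ->
  harmsum (b ^ 2) <= H ->
  `|\sum_(0 <= a < N) psi (b ^ 2) (m * a ^ 2)| <=
  N%:R * I%:R / (b ^ 2)%:R + N%:R / (2 * (b ^ 2)%:R) +
  2 * H ^+ 2 * (24 * N%:R * Num.sqrt (m%:R / I%:R) + 3 * (b%:R / Num.sqrt m%:R)).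
Proof.
move=> m0 b0 I0 hH; set D := (b ^ 2)%N.
have D_gt0 : (0 < D)%N by rewrite expn_gt0 b0.
have D0 : 0 < D%:R :> R by rewrite ltr0n.
have m0' : 0 < m%:R :> R by rewrite ltr0n.
have I0' : 0 < I%:R :> R by rewrite ltr0n.
have p0 := @pi_gt0 R; have p2 := @pi_ge2 R; have p4 := @pihalf_lt2 R.
have N0 : 0 <= N%:R :> R by [].
have H1 : 1 <= H by apply: le_trans hH; apply: harmsum_ge1.
pose th u : R := 2 * pi * u%:R * m%:R / D%:R.
pose B0 u := H * (6 * N%:R * Num.sqrt (th u) + 3 / Num.sqrt (th u)).
set K := _ + 3 * _.
have th0 u : (0 < u)%N -> 0 < th u.
  by move=> u0; rewrite /th divr_gt0 ?mulr_gt0 ?ltr0n.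
have mn h : (0 < h < D)%N -> (0 < minn h (D - h))%N /\ (2 * minn h (D - h) <= D)%N.
  by move=> hD; lia.
have cosB0 u phi : (0 < u)%N ->
    `|\sum_(0 <= a < N) cos (pi * u%:R / D%:R * (m * a ^ 2)%:R *+ 2 + phi)| <= B0 u.
  move=> u0; rewrite (eq_bigr (fun a => cos (th u * a%:R ^+ 2 + phi))); last first.
    by move=> a _; rewrite natrM natrX /th; congr cos; ring.
  apply: sum_cos_sqr_le => //; first exact: th0.
  apply: le_trans hH; apply: harmsum_le.
  have thD : (th u)^-1 <= D%:R.
    have u1 : 1 <= u%:R :> R by rewrite ler1n.
    have m1 : 1 <= m%:R :> R by rewrite ler1n.
    rewrite -[leRHS]invrK lef_pV2 ?posrE ?invr_gt0 ?th0 // /th.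
    rewrite -[leLHS]mul1r ler_pM2r ?invr_gt0 //.
    have : 1 <= u%:R * m%:R :> R by rewrite -natrM ler1n muln_gt0 u0.
    nra.
  by rewrite -(ler_nat R) (le_trans _ thD) // truncn_le invr_ge0 ltW ?th0.
have hB h phi : (1 <= h < D)%N ->
    `|\sum_(0 <= a < N) cos (pi * h%:R / D%:R * (m * a ^ 2)%:R *+ 2 + phi)| <= B0 (minn h (D - h)).
  move=> hD; have [u0 _] := mn h hD.
  move: u0; rewrite /minn; case: ifP => _ u0; first exact: cosB0.
  rewrite (eq_bigr (fun a => cos (pi * (D - h)%:R / D%:R * (m * a ^ 2)%:R *+ 2 - phi))).
    exact: cosB0.
  by move=> a _; rewrite cos_frac_sym // opprK.
apply: le_trans (@sum_psi_le D I N (fun a => m * a ^ 2)%N _ D_gt0 I0 hB) _.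
rewrite mulrDr addrA; apply: lerD.
  by rewrite lerD2l mulrC.
have term h : (1 <= h < D)%N -> B0 (minn h (D - h)) *
    Num.min 1 (I%:R * sin (pi * h%:R / D%:R))^-1 / sin (pi * h%:R / D%:R) <=
    2 * D%:R * H * K * (h%:R^-1 + (D - h)%:R^-1).
  move=> hD; have [u0 uD] := mn h hD; set u := minn _ _ in u0 uD *.
  have su : sin (pi * h%:R / D%:R) = sin (pi * u%:R / D%:R) :> R.
    by rewrite /u /minn; case: ifP => // _; rewrite sin_frac_sym.
  have uV : u%:R^-1 <= h%:R^-1 + (D - h)%:R^-1 :> R.
    by rewrite /u /minn; case: ifP => _; rewrite ?lerDl ?lerDr invr_ge0.
  have s_ge := sin_frac_ge u0 uD; rewrite -su in s_ge.
  move: s_ge; set s := sin _ => s_ge.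
  have u0' : 0 < u%:R :> R by rewrite ltr0n.
  have us0 : 0 < u%:R / (2 * D%:R) :> R by rewrite divr_gt0 ?mulr_gt0.
  have s0 : 0 < s by apply: lt_le_trans s_ge.
  have sV : s^-1 <= 2 * D%:R / u%:R.
    by rewrite -[leRHS]invf_div lef_pV2.
  have zs : Num.min 1 (I%:R * s)^-1 <= Num.sqrt (2 * D%:R / (u%:R * I%:R)).
    apply: le_trans (min1_le_sqrt _) _; first by rewrite invr_ge0 mulr_ge0 // ltW.
    apply: ler_wsqrtr; rewrite invfM.
    have -> : 2 * D%:R / (u%:R * I%:R) = I%:R^-1 * (2 * D%:R / u%:R) :> R.
      by field; rewrite !gt_eqF.
    by rewrite ler_pM2l ?invr_gt0.
  have z0 : 0 <= Num.min 1 (I%:R * s)^-1.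
    by rewrite le_min ler01 invr_ge0 mulr_ge0 // ltW.
  have z1 : Num.min 1 (I%:R * s)^-1 <= 1 by rewrite ge_min lexx.
  have BK : B0 u * Num.min 1 (I%:R * s)^-1 <= H * K.
    rewrite /B0 -mulrA ler_pM2l; last by lra.
    rewrite mulrDl; apply: lerD.
      have -> : 24 * N%:R * Num.sqrt (m%:R / I%:R) = 6 * N%:R * Num.sqrt (16 * (m%:R / I%:R)) :> R.
        have s16 : Num.sqrt (16 * (m%:R / I%:R)) = 4 * Num.sqrt (m%:R / I%:R) :> R.
          have <- : 4 ^+ 2 = 16 :> R by ring.
          by rewrite sqrtrM ?sqr_ge0 // sqrtr_sqr ger0_norm.
        by rewrite s16; ring.
      rewrite -[leLHS]mulrA; apply: ler_wpM2l; first by rewrite mulr_ge0.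
      apply: le_trans (ler_wpM2l (sqrtr_ge0 _) zs) _.
      rewrite -(sqrtrM _ (ltW (th0 u u0))); apply: ler_wsqrtr.
      have -> : th u * (2 * D%:R / (u%:R * I%:R)) = 4 * pi * (m%:R / I%:R).
        by rewrite /th; field; rewrite !gt_eqF.
      rewrite ler_pM2r ?divr_gt0 //; lra.
    apply: le_trans (_ : 3 / Num.sqrt (th u) <= _).
      by rewrite ler_piMr // divr_ge0 ?sqrtr_ge0.
    rewrite ler_pM2l //.
    have -> : b%:R / Num.sqrt m%:R = (Num.sqrt (m%:R / D%:R))^-1 :> R.
      rewrite (sqrtrM _ (ltW m0')) (sqrtrV (ltW D0)) /D natrX sqrtr_sqr ger0_norm //.
      by rewrite invfM invrK mulrC.
    rewrite lef_pV2 ?posrE ?sqrtr_gt0 ?th0 ?divr_gt0 //.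
    apply: ler_wsqrtr; rewrite /th ler_pM2r ?invr_gt0 // -[leLHS]mul1r ler_pM2r //.
    have : 1 <= u%:R :> R by rewrite ler1n.
    nra.
  have K0 : 0 <= K.
    by rewrite /K addr_ge0 ?mulr_ge0 ?invr_ge0 ?sqrtr_ge0.
  apply: le_trans (_ : H * K * (2 * D%:R / u%:R) <= _).
    apply: ler_pM => //; rewrite ?invr_ge0 ?(ltW s0) // mulr_ge0 //.
    by rewrite /B0 mulr_ge0 ?addr_ge0 ?mulr_ge0 ?invr_ge0 ?sqrtr_ge0 //; lra.
  have -> : H * K * (2 * D%:R / u%:R) = 2 * D%:R * H * K * u%:R^-1 by ring.
  by rewrite ler_wpM2l ?mulr_ge0 //; lra.
apply: le_trans (_ : (2 * D%:R)^-1 * (2 * D%:R * H * K * (harmsum D *+ 2)) <= _).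
  rewrite ler_pM2l ?invr_gt0 ?mulr_gt0 //.
  apply: le_trans (ler_sum_nat term) _.
  rewrite -big_distrr ler_wpM2l ?mulr_ge0 //=; first lra.
    by rewrite /K addr_ge0 ?mulr_ge0 ?invr_ge0 ?sqrtr_ge0.
  rewrite big_split /= mulr2n.
  have hD : \sum_(1 <= h < D) h%:R^-1 <= harmsum D.
    by rewrite /harmsum big_nat_recr //= lerDl invr_ge0.
  apply: lerD => //; apply: le_trans hD.
  rewrite big_nat_rev /= le_eqVlt; apply/orP; left; apply/eqP.
  by apply: eq_big_nat => h hD; congr (_%:R^-1); lia.
have -> : (2 * D%:R)^-1 * (2 * D%:R * H * K * (harmsum D *+ 2)) = 2 * (H * harmsum D) * K.
  by field; exact: lt0r_neq0.
apply: ler_wpM2r; first by rewrite /K addr_ge0 ?mulr_ge0 ?invr_ge0 ?sqrtr_ge0.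
by rewrite ler_pM2l // expr2 ler_pM2l //; lra.
Qed.

Lemma sum_psi_half_le T m b H q : 1 <= q -> q ^+ 4 = T%:R -> q ^+ 2 <= m%:R ->
  (m <= T)%N -> (0 < b <= T)%N -> harmsum (T ^ 2) <= H ->
  `|\sum_(0 <= a < b./2.+1) psi (b ^ 2) (m * a ^ 2)| <= 57 * H ^+ 2 * q ^+ 3.
Proof.
move=> q1 qT qm mT /andP[b0 bT] hH.
have q0 : 0 < q by lra.
have m0 : (0 < m)%N by rewrite -(ltr0n R); apply: lt_le_trans qm; rewrite exprn_gt0.
have m0' : 0 < m%:R :> R by rewrite ltr0n.
set D := (b ^ 2)%N; set N := b./2.+1.
have D_gt0 : (0 < D)%N by rewrite expn_gt0 b0.
have D0 : 0 < D%:R :> R by rewrite ltr0n.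
have b0' : 0 < b%:R :> R by rewrite ltr0n.
have Nb : N%:R <= b%:R :> R by rewrite ler_nat /N; lia.
have DbE : D%:R = b%:R ^+ 2 :> R by rewrite /D natrX.
have bT' : b%:R <= q ^+ 4 by rewrite qT ler_nat.
have mT' : m%:R <= q ^+ 4 by rewrite qT ler_nat.
have hb : harmsum (b ^ 2) <= H by apply: le_trans hH; apply: harmsum_le; rewrite leq_sqr.
have H1 : 1 <= H by apply: le_trans hb; apply: harmsum_ge1.
pose I := (Num.truncn (D%:R / q ^+ 2)).+1.
have /andP[Ile Igt] : (Num.truncn (D%:R / q ^+ 2))%:R <= D%:R / q ^+ 2 < I%:R.
  by apply: truncn_itv; rewrite divr_ge0 ?exprn_ge0 // ltW.
have {}Ile : I%:R <= D%:R / q ^+ 2 + 1 by rewrite /I -natr1 lerD2r.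
have I0 : 0 < I%:R :> R by rewrite ltr0n.
apply: le_trans (sum_psi_quadratic_le (I := I) N m0 b0 _ hb) _ => //.
have b1 : 1 <= b%:R :> R by rewrite ler1n.
have t1 : N%:R * I%:R / D%:R <= q ^+ 2 + 1.
  apply: le_trans (_ : b%:R * (D%:R / q ^+ 2 + 1) / D%:R <= _).
    by rewrite ler_pM2r ?invr_gt0 // ler_pM // ltW.
  have -> : b%:R * (D%:R / q ^+ 2 + 1) / D%:R = b%:R / q ^+ 2 + b%:R^-1.
    by rewrite DbE; field; rewrite !gt_eqF.
  apply: lerD; last by rewrite invf_le1.
  by rewrite ler_pdivrMr ?exprn_gt0 // -exprD.
have t2 : N%:R / (2 * D%:R) <= 1 :> R.
  rewrite ler_pdivrMr ?mulr_gt0 // mul1r DbE; nra.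
have t3 : N%:R * Num.sqrt (m%:R / I%:R) <= q ^+ 3.
  have {1}-> : N%:R = Num.sqrt (N%:R ^+ 2) :> R by rewrite sqrtr_sqr ger0_norm.
  have -> : q ^+ 3 = Num.sqrt ((q ^+ 3) ^+ 2) by rewrite sqrtr_sqr ger0_norm // exprn_ge0 // ltW.
  rewrite -sqrtrM ?sqr_ge0 //; apply: ler_wsqrtr.
  rewrite mulrA ler_pdivrMr //.
  apply: le_trans (_ : b%:R ^+ 2 * q ^+ 4 <= _).
    by rewrite ler_pM ?sqr_ge0 ?(ltW m0') // ler_pXn2r ?nnegrE ?(ltW b0').
  rewrite -DbE; move/ltW: Igt; rewrite ler_pdivrMr ?exprn_gt0 // => Igt.
  apply: le_trans (_ : (I%:R * q ^+ 2) * q ^+ 4 <= _); first by rewrite ler_pM2r ?exprn_gt0.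
  by rewrite -mulrA -exprD -exprM mulrC.
have t4 : b%:R / Num.sqrt m%:R <= q ^+ 3.
  have sm : q <= Num.sqrt m%:R.
    have -> : q = Num.sqrt (q ^+ 2) by rewrite sqrtr_sqr ger0_norm // ltW.
    exact: ler_wsqrtr.
  rewrite ler_pdivrMr; last exact: lt_le_trans sm.
  apply: le_trans bT' _.
  by rewrite exprSr ler_pM2l ?exprn_gt0.
have hb1 : 1 <= harmsum (b ^ 2) by apply: harmsum_ge1.
have H2 : 1 <= H ^+ 2 by rewrite exprn_ege1.
have q3 : q ^+ 2 <= q ^+ 3 by rewrite [leRHS]exprS ler_peMl // sqr_ge0.
have q2 : 1 <= q ^+ 2 by rewrite exprn_ege1.
have Hq : q ^+ 3 <= H ^+ 2 * q ^+ 3 by rewrite ler_peMl // exprn_ge0 // ltW.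
have t5 : 24 * N%:R * Num.sqrt (m%:R / I%:R) + 3 * (b%:R / Num.sqrt m%:R) <= 27 * q ^+ 3.
  rewrite -mulrA; lra.
have {}t5 : 2 * H ^+ 2 * (24 * N%:R * Num.sqrt (m%:R / I%:R) + 3 * (b%:R / Num.sqrt m%:R))
    <= 2 * H ^+ 2 * (27 * q ^+ 3).
  by rewrite ler_pM2l // mulr_gt0 //; lra.
apply: le_trans (lerD (lerD t1 t2) t5) _.
have -> : 2 * H ^+ 2 * (27 * q ^+ 3) = 54 * (H ^+ 2 * q ^+ 3) by ring.
have -> : 57 * H ^+ 2 * q ^+ 3 = 57 * (H ^+ 2 * q ^+ 3) by ring.
lra.
Qed.

(** * The error term *)

Lemma frMM e a b : (0 < e)%N -> fr R (a * e) (b * e) = fr R a b.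
Proof.
move=> e0; rewrite /fr !natrM -mulf_div divff ?mulr1 //.
by rewrite pnatr_eq0 -lt0n.
Qed.

Lemma psiMM e a b m : (0 < e)%N -> psi ((b * e) ^ 2) (m * (a * e) ^ 2) = psi (b ^ 2) (m * a ^ 2).
Proof.
move=> e0; rewrite /psi !expnMn mulnA -muln_modl !natrM -mulf_div divff ?mulr1 //.
by rewrite -natrM pnatr_eq0 -lt0n muln_gt0 e0.
Qed.

Lemma norm_psi_le D j : `|psi D j| <= 2^-1.
Proof.
rewrite /psi; case: D => [|D]; first by rewrite invr0 mulr0 sub0r normrN ger0_norm.
have : 0 <= ((j %% D.+1)%:R / D.+1%:R : R) <= 1.
  by rewrite divr_ge0 //= ler_pdivrMr // mul1r ler_nat ltnW // ltn_mod.
by move: (_ / _ : R) => x /andP[x0 x1]; rewrite ler_norml; apply/andP; split; lra.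
Qed.

Lemma halfE a b : (0 < b)%N -> (fr R a b <= 2^-1) = (a < b./2.+1)%N.
Proof.
move=> b0; rewrite /fr ler_pdivrMr ?ltr0n // mulrC ler_pdivlMr //.
by rewrite -natrM ler_nat; lia.
Qed.

Lemma card_farey_above a b m : (a <= b)%N -> (0 < b)%N -> (0 < m)%N ->
  \sum_(0 <= c < m) (if (1 - fr R a b ^+ 2 <= fr R c m) && (fr R c m <= 1) then 1 else 0) =
  ((m * a ^ 2) %/ b ^ 2)%:R :> R.
Proof.
move=> ab b0 m0; set q := ((m * a ^ 2) %/ b ^ 2)%N.
have b20 : (0 < b ^ 2)%N by rewrite expn_gt0 b0.
have qm : (q <= m)%N.
  by rewrite -[leqRHS](mulnK m b20) leq_div2r // leq_mul2l leq_sqr ab orbT.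
rewrite -big_mkcond /= big_nat_rev /= big_nat_cond.
rewrite (eq_bigl (fun c => (0 <= c < m)%N && (c < q)%N)); last first.
  move=> c; apply: andb_id2l => /andP[_ cm]; rewrite add0n.
  have m0' : 0 < m%:R :> R by rewrite ltr0n.
  have b0' : 0 < b%:R ^+ 2 :> R by rewrite exprn_gt0 ?ltr0n.
  have -> : fr R (m - c.+1) m <= 1.
    by rewrite /fr ler_pdivrMr // mul1r ler_nat leq_subr.
  rewrite andbT leq_divRL // -(ler_nat R) (natrM _ c.+1) (natrM _ m) !natrX.
  have -> : fr R (m - c.+1) m = 1 - c.+1%:R / m%:R.
    by rewrite /fr natrB //; field; rewrite gt_eqF.
  rewrite lerD2l lerN2 /fr expr_div_n.
  by rewrite ler_pdivrMr // mulrAC ler_pdivlMr // [X in _ <= X]mulrC.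
rewrite -big_nat_cond -(big_nat_widen _ _ _ predT) //.
by rewrite sumr_const_nat subn0.
Qed.

Definition FareyS T m : R :=
  \sum_(b < T.+1) \sum_(a < T.+1 | farey T a b && (fr R a b <= 2^-1)) psi (b ^ 2) (m * a ^ 2).

Definition FareyK T : R := \sum_(b < T.+1) \sum_(a < T.+1 | farey T a b && (fr R a b <= 2^-1)) 1.

Lemma sum_Mertens T : (0 < T)%N ->
  \sum_(1 <= m < T.+1) Mertens (T%:R / m%:R) = 1 :> R.
Proof.
move=> T0; pose h (a b : nat) : R := (a == 0%N)%:R.
have hs e a b : (0 < e)%N -> h (a * e)%N (b * e)%N = h a b.
  by move=> e0; rewrite /h muln_eq0 (gtn_eqF e0) orbF.
transitivity (\sum_(1 <= m < T.+1) Mertens (T%:R / m%:R) * \sum_(0 <= a < m) h a m).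
  apply: eq_big_nat => m /andP[m1 _]; rewrite big_ltn // big_nat_cond big1 ?addr0 ?mulr1 //.
  by move=> a /andP[/andP[a1 _] _]; rewrite /h (gtn_eqF a1).
rewrite -farey_sum // farey_sum_nat big_ltn // big_mkcond big_nat1 /= big_nat_cond big1 ?addr0 //.
move=> b /andP[/andP[b1 _] _]; rewrite big_nat_cond big1 // => a /andP[_ cab].
rewrite /h; case: eqP => // a0; move: cab; rewrite a0 /coprime gcd0n.
by rewrite (gtn_eqF b1).
Qed.

Lemma FareyC_sub T : (0 < T)%N ->
  FareyC R T - FareyF R T * FareyG R T =
  - (\sum_(1 <= m < T.+1) Mertens (T%:R / m%:R) * FareyS T m) - FareyK T / 2.
Proof.
move=> T0; pose M m : R := Mertens (T%:R / m%:R).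
have FE : FareyF R T = \sum_(1 <= m < T.+1) M m * m%:R.
  rewrite /FareyF (farey_sum (h := fun _ _ => 1)) //; apply: eq_bigr => m _.
  by rewrite sumr_const_nat subn0.
have -> : FareyK T / 2 = \sum_(1 <= m < T.+1) M m * (FareyK T / 2).
  by rewrite -big_distrl /= sum_Mertens // mul1r.
rewrite -sumrN -sumrB.
transitivity (\sum_(b < T.+1) \sum_(a < T.+1 | farey T a b && (fr R a b <= 2^-1))
    \sum_(1 <= m < T.+1) M m * - (psi (b ^ 2) (m * a ^ 2) + 2^-1)).
  rewrite /FareyC /FareyG big_distrr -sumrB /=; apply: eq_bigr => b _.
  rewrite big_distrr -sumrB /=; apply: eq_bigr => a /andP[/and3P[ab _ _] _].
  under eq_bigr => d _ do rewrite big_mkcondr /=.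
  have b0 : (0 < b)%N by apply: leq_ltn_trans ab.
  rewrite (farey_sum (h := fun c d => if (1 - fr R a b ^+ 2 <= fr R c d) && (fr R c d <= 1)
    then 1 else 0)); last by move=> e c d e0; rewrite frMM.
  rewrite FE big_distrl -sumrB /=; apply: eq_big_nat => m /andP[m1 _].
  rewrite card_farey_above ?(ltnW ab) // -mulrA -mulrBr; congr (_ * _).
  have b20 : (b ^ 2)%:R != 0 :> R by rewrite pnatr_eq0 -lt0n expn_gt0 b0.
  have := congr1 (fun n => n%:R / (b ^ 2)%:R : R) (divn_eq (m * a ^ 2) (b ^ 2)).
  rewrite natrD natrM (natrM _ _ (b ^ 2)) mulrDl mulfK // => e.
  have -> : m%:R * fr R a b ^+ 2 = m%:R * (a ^ 2)%:R / (b ^ 2)%:R.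
    by rewrite /fr expr_div_n -!natrX mulrA.
  by rewrite e /psi; ring.
under eq_bigr => b _ do rewrite exchange_big /=.
rewrite exchange_big /=; apply: eq_bigr => m _; rewrite -/(M m); move: (M m) => Mm.
transitivity (Mm * - (FareyS T m + FareyK T / 2)); last by ring.
rewrite /FareyS /FareyK big_distrl -big_split /= -sumrN big_distrr /=.
apply: eq_bigr => b _; rewrite big_distrl -big_split /= -sumrN big_distrr /=.
by apply: eq_bigr => a _; rewrite mul1r.
Qed.

Lemma FareyK_le T : 0 <= FareyK T <= T%:R ^+ 2.
Proof.
rewrite /FareyK; apply/andP; split; first by do 2 (apply: sumr_ge0 => ? _).
under eq_bigr => b _ do rewrite big_mkcondr /=.
rewrite (farey_sum_nat (fun a b => if (fr R a b <= 2^-1) then 1 else 0 : R)).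
apply: le_trans (_ : \sum_(1 <= b < T.+1) T%:R <= _); last first.
  by rewrite sumr_const_nat subSS subn0 expr2 mulr_natl.
apply: ler_sum_nat => b /andP[_ bT].
apply: le_trans (_ : \sum_(0 <= a < b) 1 <= _); last first.
  by rewrite sumr_const_nat subn0 ler_nat -ltnS.
rewrite big_mkcond; apply: ler_sum => a _.
by do 2 case: ifP => _ //.
Qed.

Lemma norm_FareyS_le T m : `|FareyS T m| <= T%:R ^+ 2 / 2.
Proof.
have /andP[_ KT] := FareyK_le T.
apply: le_trans (_ : FareyK T / 2 <= _); last by rewrite ler_pM2r // invr_gt0.
apply: le_trans (ler_norm_sum _ _ _) _; rewrite /FareyK big_distrl /=.
apply: ler_sum => b _; apply: le_trans (ler_norm_sum _ _ _) _; rewrite big_distrl /=.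
by apply: ler_sum => a _; rewrite mul1r norm_psi_le.
Qed.

Lemma norm_mobius_le n : `|(mobius n)%:~R| <= 1 :> R.
Proof.
rewrite /mobius; case: ifP => _; last by rewrite normr0.
by rewrite rmorphXn /= rmorphN1 normrX normrN1 expr1n.
Qed.

Lemma norm_Mertens_le T m : (0 < m)%N -> `|Mertens (T%:R / m%:R : R)| <= T%:R / m%:R.
Proof.
move=> m0; rewrite Mertens_div //.
apply: le_trans (ler_norm_sum _ _ _) _.
apply: le_trans (_ : \sum_(1 <= e < (T %/ m).+1) 1 <= _).
  by apply: ler_sum => e _; apply: norm_mobius_le.
rewrite sumr_const_nat subSS subn0 ler_pdivlMr ?ltr0n // -natrM ler_nat.
exact: leq_trunc_div.
Qed.

Lemma norm_FareyS_large_le T m H q : 1 <= q -> q ^+ 4 = T%:R -> q ^+ 2 <= m%:R ->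
  (m <= T)%N -> harmsum (T ^ 2) <= H ->
  `|FareyS T m| <= 57 * T%:R * H ^+ 3 * q ^+ 3.
Proof.
move=> q1 qT qm mT hH.
have T0 : (0 < T)%N by rewrite -(ltr0n R) -qT exprn_gt0 //; lra.
have H1 : 1 <= H by apply: le_trans hH; apply: harmsum_ge1; rewrite expn_gt0 T0.
have hT : harmsum T <= H.
  by apply: le_trans hH; apply: harmsum_le; rewrite leq_pmulr.
rewrite /FareyS; under eq_bigr => b _ do rewrite big_mkcondr /=.
rewrite (farey_sum (h := fun a b => if (fr R a b <= 2^-1) then psi (b ^ 2) (m * a ^ 2) else 0));
  last by move=> e a b e0; rewrite frMM // psiMM.
apply: le_trans (ler_norm_sum _ _ _) _.
apply: le_trans (_ : \sum_(1 <= b < T.+1) b%:R^-1 * (T%:R * (57 * H ^+ 2 * q ^+ 3)) <= _).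
  apply: ler_sum_nat => b /andP[b1 bT].
  rewrite normrM [leRHS]mulrA; apply: ler_pM => //; first by rewrite [leRHS]mulrC norm_Mertens_le.
  have -> : \sum_(0 <= a < b) (if (fr R a b <= 2^-1) then psi (b ^ 2) (m * a ^ 2) else 0) =
      \sum_(0 <= a < b./2.+1) psi (b ^ 2) (m * a ^ 2).
    rewrite -big_mkcond [RHS](big_nat_widen _ _ b); last by lia.
    by apply: eq_bigl => a; rewrite halfE.
  by apply: (sum_psi_half_le q1 qT qm mT _ hH); rewrite b1 -ltnS.
rewrite -big_distrl /= -/(harmsum T).
have -> : 57 * T%:R * H ^+ 3 * q ^+ 3 = H * (T%:R * (57 * H ^+ 2 * q ^+ 3)) by ring.
by rewrite ler_wpM2r // !mulr_ge0 // ?exprn_ge0 //; lra.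
Qed.

Lemma harmsum_le_ln n : (0 < n)%N -> harmsum n <= 1 + ln n%:R.
Proof.
case: n => // n _; elim: n => [|n IHn].
  by rewrite /harmsum big_nat1 invr1 ln1 addr0.
have -> : harmsum n.+2 = harmsum n.+1 + n.+2%:R^-1.
  by rewrite /harmsum big_nat_recr.
have n0 : 0 < n.+1%:R :> R by rewrite ltr0n.
have n1 : 0 < n.+2%:R :> R by rewrite ltr0n.
have : ln (n.+1%:R / n.+2%:R) <= - n.+2%:R^-1 :> R.
  have -> : n.+1%:R / n.+2%:R = 1 + - n.+2%:R^-1 :> R.
    by rewrite -[n.+2%:R]natr1; field; apply: lt0r_neq0; lra.
  by apply: le_ln1Dx; rewrite ltrN2 invf_lt1 // ltr1n.
rewrite ln_div ?posrE // => h.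
move: h IHn; move: (ln n.+1%:R) (ln n.+2%:R) (n.+2%:R^-1) (harmsum n.+1) => x y z t; lra.
Qed.

Lemma ln_le_sqrt (x : R) : 0 <= x -> ln (1 + x) <= 2 * Num.sqrt x.
Proof.
move=> x0; have s0 := sqrtr_ge0 x; have ss := sqr_sqrtr x0.
apply: le_trans (_ : ln ((1 + Num.sqrt x) ^+ 2) <= _).
  rewrite ler_ln ?posrE; [nra|lra|rewrite exprn_gt0 //; lra].
rewrite lnXn; last lra.
have : ln (1 + Num.sqrt x) <= Num.sqrt x by apply: le_ln1Dx; lra.
lra.
Qed.

Lemma cvg_lnln_div_ln :
  (4 * ln (1 + ln n%:R) / ln n%:R : R) @[n --> \oo] --> (0 : R).
Proof.
apply/cvgrPdist_le => e e0; near=> n.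
rewrite sub0r normrN.
have hn : expR ((8 / e) ^+ 2) <= n%:R :> R.
  apply: le_trans (ltW (truncnS_gt _)) _; rewrite ler_nat.
  by near: n; exact: nbhs_infty_ge.
have L0 : (8 / e) ^+ 2 <= ln n%:R.
  by rewrite -[leLHS]expRK ler_ln ?posrE ?expR_gt0 // (lt_le_trans (expR_gt0 _) hn).
have e8 : 0 < 8 / e by rewrite divr_gt0.
move: L0; set x := ln _ => L0.
have x0 : 0 < x by apply: lt_le_trans L0; rewrite exprn_gt0.
have sx : 8 / e <= Num.sqrt x.
  rewrite -[leLHS]gtr0_norm // -sqrtr_sqr; exact: ler_wsqrtr.
rewrite ger0_norm; last by rewrite !mulr_ge0 ?invr_ge0 ?(ltW x0) // ln_ge0; lra.
rewrite ler_pdivrMr //.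
have := ln_le_sqrt (ltW x0); have ss := sqr_sqrtr (ltW x0).
have s0 : 0 <= Num.sqrt x := sqrtr_ge0 x.
move: sx; rewrite ler_pdivrMr // => sx h.
have : 8 * Num.sqrt x <= Num.sqrt x * e * Num.sqrt x by rewrite ler_wpM2r.
nra.
Unshelve. all: by end_near.
Qed.

Lemma powR_main T q : (0 < T)%N -> 0 < q -> q ^+ 4 = T%:R ->
  T%:R `^ (11 / 4 + 4 * ln (1 + ln T%:R) / ln T%:R) =
  q ^+ 11 * (1 + ln T%:R) ^+ 4 :> R.
Proof.
move=> T0 q0 qT; have T0' : 0 < T%:R :> R by rewrite ltr0n.
rewrite powRD; last by rewrite (gt_eqF T0') implybT.
congr (_ * _).
  rewrite -qT -powR_mulrn ?ltW // -powRrM -powR_mulrn ?ltW //; congr (_ `^ _).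
  by field.
have [->|T1] := eqVneq T 1%N; first by rewrite powR1 ln1 addr0 expr1n.
have l0 : 0 < ln T%:R :> R by rewrite ln_gt0 // ltr1n ltn_neqAle eq_sym T1.
rewrite /powR gt_eqF // mulfVK ?gt_eqF //.
rewrite -[RHS]lnK ?posrE ?exprn_gt0 //; [|lra].
by rewrite lnXn ?mulr_natl //; lra.
Qed.

End RealSums.

Theorem theorem1p1 (R : realType) :
  exists c : R, 0 < c /\
  exists eps : nat -> R, eps n @[n --> \oo] --> 0 /\
  forall delta : R -> R,
    (forall s t : R, 1 <= s -> s <= t -> delta t <= delta s) ->
    (forall t : R, 1 <= t -> `|Mertens t| <= t * delta t) ->
    forall T : nat, (1 <= T)%N ->
      `|FareyC R T - FareyF R T * FareyG R T|
        <= c * (T%:R `^ (11 / 4 + eps T)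
                + T%:R ^+ 3 * delta (Num.sqrt T%:R) * ln T%:R).
Proof.
exists 1000; split; first by rewrite ltr0n.
exists (fun n => 4 * ln (1 + ln n%:R) / ln n%:R); split; first exact: cvg_lnln_div_ln.
move=> delta delta_dec deltaM T T0.
have T1 : 1 <= T%:R :> R by rewrite ler1n.
have T0' : 0 < T%:R :> R by rewrite ltr0n.
pose q : R := Num.sqrt (Num.sqrt T%:R).
have q2 : q ^+ 2 = Num.sqrt T%:R by rewrite sqr_sqrtr ?sqrtr_ge0.
have qT : q ^+ 4 = T%:R by rewrite (exprM q 2 2) q2 sqr_sqrtr // ltW.
have q0 : 0 < q by rewrite !sqrtr_gt0.
have q1 : 1 <= q by rewrite -(expr_ge1 (n := 4)) ?qT // ltW.
rewrite (@powR_main R T q) // -q2.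
pose l : R := 1 + ln T%:R; rewrite -/l.
have lnT0 : 0 <= ln T%:R :> R by rewrite ln_ge0.
pose H := harmsum R (T ^ 2).
have H1 : 1 <= H by apply: harmsum_ge1; rewrite expn_gt0 T0.
have Hl : H <= 2 * l.
  apply: le_trans (harmsum_le_ln _ _) _; first by rewrite expn_gt0 T0.
  by rewrite natrX lnXn // /l; lra.
have hTH : harmsum R T <= H by apply: harmsum_le; rewrite leq_pmulr.
have d0 : 0 <= delta (q ^+ 2).
  have := le_trans (normr_ge0 _) (deltaM _ (exprn_ege1 2 q1)).
  by rewrite pmulr_rge0 // exprn_gt0.
pose X : R := if T == 1%N then 0 else delta (q ^+ 2) * T%:R ^+ 2 / 2.
pose Y : R := 57 * T%:R * H ^+ 3 * q ^+ 3.
have X0 : 0 <= X by rewrite /X; case: ifP => // _; rewrite !mulr_ge0 // exprn_ge0 // ltW.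
have Y0 : 0 <= Y by rewrite /Y !mulr_ge0 ?exprn_ge0 //; lra.
have term m : (1 <= m < T.+1)%N ->
    `|Mertens (T%:R / m%:R : R) * FareyS R T m| <= m%:R^-1 * (T%:R * (X + Y)).
  move=> /andP[m1 mT]; have m0 : 0 < m%:R :> R by rewrite ltr0n.
  have -> : m%:R^-1 * (T%:R * (X + Y)) = T%:R / m%:R * (X + Y) by ring.
  rewrite normrM.
  have [qm|mq] := leP (q ^+ 2) m%:R.
    apply: ler_pM => //; first exact: norm_Mertens_le.
    apply: le_trans (norm_FareyS_large_le q1 qT qm _ (lexx H)) _ => //.
    by rewrite -/Y lerDr.
  have XE : X = delta (q ^+ 2) * (T%:R ^+ 2 / 2).
    rewrite /X; case: eqP => [T1'|_]; last by ring.
    exfalso; move: mq; rewrite q2 T1' sqrtr1 ltNge ler1n m1 //.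
  have qTm : q ^+ 2 <= T%:R / m%:R.
    by rewrite ler_pdivlMr // -qT (exprD q 2 2) ler_pM2l ?exprn_gt0 // ltW.
  apply: le_trans (_ : T%:R / m%:R * X <= _); last first.
    by rewrite ler_pM2l ?divr_gt0 // lerDl.
  rewrite XE mulrA; apply: ler_pM => //; last exact: norm_FareyS_le.
  have q21 : 1 <= q ^+ 2 by rewrite exprn_ege1.
  apply: le_trans (deltaM _ (le_trans q21 qTm)) _.
  by rewrite ler_pM2l ?divr_gt0 // delta_dec.
have sumb : `|\sum_(1 <= m < T.+1) Mertens (T%:R / m%:R) * FareyS R T m| <=
    harmsum R T * (T%:R * (X + Y)).
  apply: le_trans (ler_norm_sum _ _ _) _.
  by rewrite /harmsum big_distrl /=; apply: ler_sum_nat => m /term.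
rewrite FareyC_sub //.
have /andP[K0 KT] := FareyK_le R T.
apply: le_trans (ler_normB _ _) _; rewrite normrN [X in _ + X]ger0_norm ?divr_ge0 //.
have T2 : T%:R ^+ 2 = q ^+ 8 by rewrite -qT -exprM.
have l1 : 1 <= l by rewrite /l; lra.
have bY : harmsum R T * (T%:R * Y) <= 912 * (q ^+ 11 * l ^+ 4).
  apply: le_trans (_ : H * (T%:R * Y) <= _); first by rewrite ler_wpM2r // mulr_ge0.
  have -> : H * (T%:R * Y) = 57 * (T%:R ^+ 2 * q ^+ 3) * H ^+ 4 by rewrite /Y; ring.
  rewrite T2 -exprD.
  have -> : 912 * (q ^+ 11 * l ^+ 4) = 57 * q ^+ 11 * (2 * l) ^+ 4 by ring.
  by rewrite ler_pM2l ?mulr_gt0 ?exprn_gt0 // lerXn2r ?nnegrE //; lra.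
have d1 : 0 <= T%:R ^+ 3 * delta (q ^+ 2) * ln T%:R.
  by rewrite !mulr_ge0 // exprn_ge0 // ltW.
have bX : harmsum R T * (T%:R * X) <= 2 * (T%:R ^+ 3 * delta (q ^+ 2) * ln T%:R).
  rewrite /X; case: eqP => [_|/eqP T1']; first by rewrite !mulr0 mulr_ge0.
  have T2' : 2 <= T%:R :> R by rewrite ler_nat ltn_neqAle eq_sym T1'.
  have ln2 : 2^-1 <= ln T%:R :> R.
    have : ln (1 + - 2^-1) <= - 2^-1 :> R by apply: le_ln1Dx; lra.
    have -> : 1 + - 2^-1 = 2^-1 :> R by field.
    rewrite lnV ?posrE // => h2.
    apply: le_trans (_ : ln 2 <= _); first by rewrite -lerN2.
    by rewrite ler_ln ?posrE.
  apply: le_trans (_ : (3 * ln T%:R) * (T%:R * (delta (q ^+ 2) * T%:R ^+ 2 / 2)) <= _).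
    rewrite ler_wpM2r //; first by rewrite !mulr_ge0 // ?exprn_ge0 // ltW.
    move: (harmsum_le_ln R T0) ln2; move: (harmsum R T) (ln T%:R) => x y; lra.
  have -> : 3 * ln T%:R * (T%:R * (delta (q ^+ 2) * T%:R ^+ 2 / 2)) =
    3 / 2 * (T%:R ^+ 3 * delta (q ^+ 2) * ln T%:R) by field.
  by rewrite ler_wpM2r //; lra.
have bK : FareyK R T / 2 <= q ^+ 11 * l ^+ 4.
  have q811 : q ^+ 8 <= q ^+ 11 by rewrite ler_weXn2l.
  have l4 : q ^+ 11 <= q ^+ 11 * l ^+ 4.
    by rewrite ler_peMr ?exprn_ge0 ?exprn_ege1 // ltW.
  rewrite T2 in KT; lra.
have p0 : 0 <= q ^+ 11 * l ^+ 4 by rewrite mulr_ge0 // exprn_ge0 //; lra.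
rewrite 2!mulrDr in sumb.
apply: le_trans (lerD sumb bK) _; rewrite mulrDr.
move: (q ^+ 11 * l ^+ 4) (T%:R ^+ 3 * _ * _) bX bY p0 d1 => u v; lra.
Qed.
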